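(* For all types $\sigma,\tau\Vdash n$, the coefficient of $m_{\tau}^{\otimes}$ in the $m^{\otimes}$-expansion of $P_{\sigma}$ is \[ \mathcal{M}(P,m^{\otimes})_{\tau,\sigma} =\sum_{T\in\mathrm{PTBT}(\tau,\sigma)} \operatorname{wt}(T). \]
   Context: An integer partition is a finite (possibly empty) weakly decreasing sequence of positive integers. A block is an ordered pair of positive integers written $d^m$ (degree $d$, multiplicity $m$). Blocks are ordered by $a^b\ge d^e$ iff $a>d$, or $a=d$ and $b\ge e$. A type is a finite (possibly empty) weakly decreasing sequence of blocks $\tau=(d_1^{e_1},\dots,d_s^{e_s})$; its weight is $|\tau|=\sum_id_ie_i$, and $\tau\Vdash n$ means $|\tau|=n$. For $k\ge1$, $\tau|_k$ denotes the integer partition formed by the multiplicities of the blocks of $\tau$ of degree $k$. The tensor diagram of $\tau$ is the sequence of partition diagrams $\mathrm{dg}(\tau|_1)\otimes\mathrm{dg}(\tau|_2)\otimes\cdots$; the $k$th component has left-justified rows of boxes of lengths the parts of $\tau|_k$. Variables: $x_{k,j}$ for $k,j\ge 1$, with $\deg x_{k,j}=k$; $\mathbf{x}_{k*}=(x_{k,1},x_{k,2},\dots)$. The graded algebra $\mathsf{P\Lambda}=\bigoplus_n\mathsf{P\Lambda}^n$ of polysymmetric functions consists of the formal series over $\mathbb{Q}$ of bounded degree in all the $x_{k,j}$ that, for each fixed $k$, are unchanged by any permutation of the variables $\mathbf{x}_{k*}$. Define $m^{\otimes}_\tau=\prod_{k\ge1}m_{\tau|_k}(\mathbf{x}_{k*})$,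 where $m_\lambda$ is the monomial symmetric function; $\{m^\otimes_\tau:\tau\Vdash n\}$ is a basis of $\mathsf{P\Lambda}^n$. Define $P_d=\sum_{k\mid d}k\sum_{j\ge1}x_{k,j}^{d/k}$, let $P_{d^e}$ be obtained from $P_d$ by replacing every variable $x_{k,j}$ by $x_{k,j}^e$, and set $P_\sigma=\prod_{i=1}^sP_{d_i^{e_i}}$ for $\sigma=(d_1^{e_1},\dots,d_s^{e_s})$. The transition matrix is defined by $P_\sigma=\sum_{\tau\Vdash n}\mathcal{M}(P,m^\otimes)_{\tau,\sigma}m^\otimes_\tau$ for $\sigma\Vdash n$. For $\sigma=(d_1^{e_1},\dots,d_s^{e_s})$, $\mathrm{PTBT}(\tau,\sigma)$ is the set of $P$-tensor brick tabloids of shape $\tau$ and content $\sigma$: coverings of the tensor diagram of $\tau$ by labeled horizontal bricks (height $1$, lying within a single row of a component), with labels in $\{1,\dots,s\}$, such that: every box is covered by exactly one brick; the brick labels in each row of each component strictly increase from left to right; and for each $1\le i\le s$ exactly one brick labeled $i$ is used, placed in the $k_i$th component for some positive divisor $k_i$ of $d_i$ and having length $d_ie_i/k_i$. The weight $\operatorname{wt}(T)=\prod_{k\ge1}k^{n_k(T)}$, where $n_k(T)$ is the number of bricks in component $k$. *)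

(* Defs.v *)
From HB Require Import structures.
From mathcomp Require Import all_boot all_order all_algebra finmap.
From mathcomp Require Import boolp classical_sets functions cardinality fsbigop.
From mathcomp Require Import monalg.

Set Implicit Arguments.
Unset Strict Implicit.
Unset Printing Implicit Defensive.

Import GRing.Theory.
Local Open Scope ring_scope.

(* The block d^m is the pair (d, m); positivity is imposed in [is_type]. *)
Definition block := (nat * nat)%type.

Definition block_ge (b c : block) : bool :=
  (c.1 < b.1)%N || (b.1 == c.1) && (c.2 <= b.2)%N.

Definition is_type (t : seq block) : bool :=
  all (fun b => (0 < b.1) && (0 < b.2))%N t && sorted block_ge t.

Definition weight (t : seq block) : nat := (\sum_(b <- t) b.1 * b.2)%N.

Record ptype (n : nat) := PType {
  ptype_seq :> seq block;
  ptypeP : is_type ptype_seq && (weight ptype_seq == n) }.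

HB.instance Definition _ n := [isSub for @ptype_seq n].
HB.instance Definition _ n := [Countable of ptype n by <:].

Section PTypeFinite.
Variable n : nat.

Lemma weight_ge (t : seq block) (b : block) :
  b \in t -> (b.1 * b.2 <= weight t)%N.
Proof. by move=> bt; rewrite /weight (big_rem b) //= leq_addr. Qed.

Lemma size_le_weight (t : seq block) : is_type t -> (size t <= weight t)%N.
Proof.
case/andP=> /allP pos _; rewrite /weight -sum1_size !big_seq.
by apply: leq_sum => b /pos /andP[? ?]; rewrite muln_gt0; apply/andP.
Qed.

Let enc (t : ptype n) : n.-bseq ('I_n.+1 * 'I_n.+1) :=
  insub_bseq n [seq (inord b.1, inord b.2) | b <- ptype_seq t].
Let dec (u : n.-bseq ('I_n.+1 * 'I_n.+1)) : option (ptype n) :=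
  insub [seq (val b.1, val b.2) | b <- u].

Let encK : pcancel enc dec.
Proof.
move=> t; rewrite /dec /enc; have /andP[tt /eqP wt] := ptypeP t.
rewrite /insub_bseq insubdK; last first.
  by rewrite -topredE /= size_map -[X in (_ <= X)%N]wt size_le_weight.
rewrite -map_comp (_ : map _ _ = ptype_seq t) ?valK //.
rewrite -[RHS]map_id; apply/eq_in_map => -[d e] det /=.
have /= := weight_ge det; rewrite wt.
case/andP: tt => /allP /(_ _ det) /= /andP[d0 e0] _ le.
rewrite !inordK // ltnS; first by apply: leq_trans le; rewrite leq_pmull.
by apply: leq_trans le; rewrite leq_pmulr.
Qed.

HB.instance Definition _ : isFinite (ptype n) := PCanIsFinite encK.

End PTypeFinite.

(* tau|_k; it is weakly decreasing because tau is. *)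
Definition mults (t : seq block) (k : nat) : seq nat :=
  [seq b.2 | b <- t & b.1 == k].

(* The pair (k, j) : nat * nat indexes the variable x_{k+1,j+1}. *)
Definition monomial := {cmonom (nat * nat)%type}.

(* A series is the function giving the coefficient of each monomial.  The alias
   hides the pointwise product carried by the function type. *)
Definition series : Type := monomial -> rat.

HB.instance Definition _ := Choice.on series.
HB.instance Definition _ := GRing.Zmodule.copy series (monomial -> rat).
HB.instance Definition _ := GRing.Lmodule.copy series (monomial -> rat^o).

Section SeriesRing.
Implicit Types (m : monomial) (f g h : series).

Definition factorizations m : set (monomial * monomial) :=
  [set p | mmul p.1 p.2 = m].

Definition mons m0 : series := fun m => (m == m0)%:R.

Definition smul f g : series :=
  fun m => \sum_(p \in factorizations m) f p.1 * g p.2.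

Lemma factorizations_finite m : finite_set (factorizations m).
Proof.
pose F := {ffun finsupp m -> 'I_(mdeg m).+1}.
pose dec (u : F) : monomial :=
  mkcmonom [fsfun v : finsupp m => nat_of_ord (u v) | 0%N].
pose D (u : F * F) := (dec u.1, dec u.2).
apply: (@sub_finite_set _ _ (D @` setT)); last first.
  exact/finite_image/finite_finset.
move=> -[a b] /= abm; have lem (x y : monomial) : mmul x y = m ->
    x = dec [ffun v => inord (x (val v))].
  move=> xym; apply/eqP/cmP => i; rewrite cmE fsfun_ffun.
  case: insubP => [v vi iE|]; last first.
    rewrite -cmE_eq0 -xym cmM addn_eq0 => /andP[/eqP xi0 _].
    by rewrite xi0.
  rewrite /= ffunE iE inordK // ltnS.
  have: (x i <= m i)%N by rewrite -xym cmM leq_addr.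
  by move/leq_trans; apply; rewrite mdegE (big_fsetD1 i) //= leq_addr.
exists ([ffun v => inord (a (val v))], [ffun v => inord (b (val v))]) => //.
by rewrite /D /= -(lem a b) // -(lem b a) // mulmC.
Qed.

Let fact m : seq (monomial * monomial) := fset_set (factorizations m).

Let mem_fact m p : (p \in fact m) = (mmul p.1 p.2 == m).
Proof.
rewrite /fact in_fset_set; last exact: factorizations_finite.
by apply/idP/eqP; rewrite inE.
Qed.

Let fact_uniq m : uniq (fact m). Proof. exact: fset_uniq. Qed.

Lemma smulE f g m : smul f g m = \sum_(p <- fact m) f p.1 * g p.2.
Proof. by rewrite /smul fsbig_finite //; exact: factorizations_finite. Qed.

Lemma smulC : commutative smul.
Proof.
move=> f g; apply/funext => m; rewrite !smulE.
pose sw (p : monomial * monomial) := (p.2, p.1).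
rewrite (perm_big (map sw (fact m))); last first.
  apply: uniq_perm => //; first by rewrite map_inj_uniq // => -[? ?] [? ?] [-> ->].
  move=> [a b]; apply/idP/mapP => [|[[c d] cd [-> ->]]].
    by rewrite mem_fact /= => ab; exists (b, a) => //; rewrite mem_fact /= mulmC.
  by move: cd; rewrite !mem_fact /= mulmC.
by rewrite big_map; apply: eq_bigr => p _; rewrite mulrC.
Qed.

Lemma smulA : associative smul.
Proof.
move=> f g h; apply/funext => m; rewrite !smulE.
under eq_bigr do rewrite smulE mulr_sumr.
under [RHS]eq_bigr do rewrite smulE mulr_suml.
pose l (p q : monomial * monomial) := (p.1, q.1, q.2).
pose r (p q : monomial * monomial) := (q.1, q.2, p.2).
pose F (t : monomial * monomial * monomial) := f t.1.1 * (g t.1.2 * h t.2).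
transitivity (\sum_(t <- [seq l p q | p <- fact m, q <- fact p.2]) F t).
  by rewrite big_allpairs_dep.
transitivity (\sum_(t <- [seq r p q | p <- fact m, q <- fact p.1]) F t).
  apply: perm_big; apply: uniq_perm.
  - apply: allpairs_uniq_dep => // t t' /allpairsPdep[p [q [_ Dp ->]]].
    case/allpairsPdep=> [p' [q' [_ Dp' ->]]].
    case: p p' q q' Dp Dp' => [a b] [a' b'] [c d] [c' d'].
    by rewrite !mem_fact /= => /eqP<- /eqP<- [-> -> ->].
  - apply: allpairs_uniq_dep => // t t' /allpairsPdep[p [q [_ Dp ->]]].
    case/allpairsPdep=> [p' [q' [_ Dp' ->]]].
    case: p p' q q' Dp Dp' => [a b] [a' b'] [c d] [c' d'].
    by rewrite !mem_fact /= => /eqP<- /eqP<- [-> -> ->].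
  move=> t; apply/allpairsPdep/allpairsPdep => -[[a b] [[c d] []]].
    rewrite !mem_fact /= => /eqP abm /eqP cdb ->.
    exists (mmul a c, d), (a, c).
    by rewrite !mem_fact /= -mulmA cdb abm !eqxx.
  rewrite !mem_fact /= => /eqP abm /eqP cda ->.
  exists (c, mmul d b), (d, b).
  by rewrite !mem_fact /= mulmA cda abm !eqxx.
rewrite big_allpairs_dep; apply: eq_bigr => p _; apply: eq_bigr => q _.
by rewrite /F /= mulrA.
Qed.

Lemma smul1 : left_id (mons mone) smul.
Proof.
move=> f; apply/funext => m; rewrite smulE (bigD1_seq (mone, m)) //=; last first.
  by rewrite mem_fact /= mul1m.
rewrite /mons eqxx mul1r big_seq_cond big1 ?addr0 // => -[a b] /andP[].
rewrite mem_fact /= /mons => /eqP abm.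
have [a1|_ _] := eqVneq a mone; last by rewrite mul0r.
by rewrite xpair_eqE -abm a1 mul1m !eqxx.
Qed.

Lemma smulDl : left_distributive smul +%R.
Proof.
move=> f g h; apply/funext => m; rewrite -[RHS]/(smul f h m + smul g h m).
by rewrite !smulE -big_split; apply: eq_bigr => p _; exact: mulrDl.
Qed.

Lemma mons1_neq0 : mons mone != 0.
Proof.
by apply/eqP => /(congr1 (fun f : series => f mone)); rewrite /mons eqxx.
Qed.

HB.instance Definition _ := GRing.Zmodule_isComNzRing.Build series
  smulA smulC smul1 smulDl mons1_neq0.

Lemma smulZl (a : rat) f g : a *: (f * g) = a *: f * g.
Proof.
apply/funext => m; rewrite -[LHS]/(a * smul f g m) -[RHS]/(smul (a *: f) g m).
by rewrite !smulE mulr_sumr; apply: eq_bigr => p _; rewrite mulrA.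
Qed.

HB.instance Definition _ := GRing.Lmodule_isLalgebra.Build rat series smulZl.
HB.instance Definition _ := GRing.Lalgebra_isComAlgebra.Build rat series.

End SeriesRing.

(* Infinite sum, coefficient by coefficient; [\sum_(j \in D)] only makes sense
   when F is locally finite, i.e., each monomial occurs in finitely many F j. *)
Definition series_sum (D : set nat) (F : nat -> series) : series :=
  fun m => \sum_(j \in D) F j m.

(* var k j is x_{k,j} for k, j >= 1. *)
Definition var (k j : nat) : series := mons (ucm (k.-1, j.-1)).

(* Substitution of x_{k,j}^e for every x_{k,j} (e >= 1): the term f_m x^m
   becomes f_m (x^m)^e. *)
Definition subst_pow (e : nat) (f : series) : series :=
  fun m => \sum_(m' \in [set m' | expcmn m' e = m]) f m'.

(* The monomial symmetric function m_lambda(x_{k*}): the sum of the distinct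
   monomials in x_{k,1}, x_{k,2}, ... whose nonzero exponents are, up to order,
   the parts of lambda. *)
Definition msym (k : nat) (lambda : seq nat) : series :=
  fun m => (all (fun v => v.1.+1 == k) (finsupp m) &&
            perm_eq [seq m v | v <- finsupp m] lambda)%:R.

(* The factors with k > |tau| are m_emptyset = 1. *)
Definition mtens (tau : seq block) : series :=
  \prod_(1 <= k < (weight tau).+1) msym k (mults tau k).

Definition P_deg (d : nat) : series :=
  \sum_(k <- divisors d) k%:R *: series_sum [set j | (0 < j)%N]
                                    (fun j => var k j ^+ (d %/ k)).

Definition P_block (b : block) : series := subst_pow b.2 (P_deg b.1).

Definition P_type (sigma : seq block) : series := \prod_(b <- sigma) P_block b.

(* The matrix M(A, B) with A_sigma = sum_tau M(A, B)_{tau, sigma} B_tau, for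
   families A and B indexed by the types of weight n; meaningful when the B tau
   are linearly independent and span the A sigma. *)
Definition transition (n : nat) (A B : ptype n -> series) :
    ptype n -> ptype n -> rat :=
  xget (fun _ _ => 0)
    [set M | forall sigma, A sigma = \sum_(tau : ptype n) M tau sigma *: B tau].

(* A brick is (label, component, row, column of its leftmost box, length).
   Labels, rows and columns are numbered from 0 and components from 1; all these
   numbers are at most n for the bricks of a tabloid whose shape and content
   have weight n. *)
Definition brick (n s : nat) :=
  ('I_s * 'I_n.+1 * 'I_n * 'I_n * 'I_n.+1)%type.

Section Tabloids.
Variables n s : nat.
Implicit Type b : brick n s.

Definition blabel b : 'I_s := b.1.1.1.1.
Definition bcomp b : nat := b.1.1.1.2.
Definition brow b : nat := b.1.1.2.
Definition bcol b : nat := b.1.2.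
Definition blen b : nat := b.2.

Definition covers b (k r c : nat) : bool :=
  [&& bcomp b == k, brow b == r & (bcol b <= c < bcol b + blen b)%N].

End Tabloids.

(* The boxes (k, r, c) of the tensor diagram of tau. *)
Definition in_diagram (tau : seq block) (k r c : nat) : Prop :=
  [/\ (0 < k)%N, (r < size (mults tau k))%N & (c < nth 0%N (mults tau k) r)%N].

Record is_PTBT (n : nat) (tau sigma : seq block)
    (T : {set brick n (size sigma)}) : Prop := IsPTBT {
  PTBT_inside : forall b, b \in T -> forall k r c,
    covers b k r c -> in_diagram tau k r c;
  PTBT_cover : forall k r c, in_diagram tau k r c ->
    #|[set b in T | covers b k r c]| = 1%N;
  PTBT_increasing : forall b b', b \in T -> b' \in T ->
    bcomp b = bcomp b' -> brow b = brow b' -> (bcol b < bcol b')%N ->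
    (blabel b < blabel b')%N;
  PTBT_label : forall i : 'I_(size sigma),
    #|[set b in T | blabel b == i]| = 1%N;
  PTBT_length : forall b, b \in T ->
    let: (d, e) := nth (0%N, 0%N) sigma (blabel b) in
    (bcomp b %| d)%N /\ blen b = (d * e %/ bcomp b)%N }.

Definition PTBT (n : nat) (tau sigma : seq block) :
    {set {set brick n (size sigma)}} :=
  [set T | `[< is_PTBT tau T >]]%SET.

Definition wt (n s : nat) (T : {set brick n s}) : nat :=
  (\prod_(1 <= k < n.+1) k ^ #|[set b in T | bcomp b == k]|)%N.

(* Main.v *)
Require Import Defs.
From mathcomp Require Import all_boot all_order all_algebra finmap.
From mathcomp Require Import boolp classical_sets functions cardinality fsbigop.
From mathcomp Require Import monalg.
From mathcomp Require Import zify.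

(** The coefficient of a monomial [m] in [P_sigma] is found by expanding the
product.  The factor [P_{d^e}] is the sum of [k x_{k,j}^{d e / k}] over the
variables [x_{k,j}] with [k | d]; hence the coefficient is a sum over the ways
[f] of picking one variable [f i] in each factor such that, for every variable
[v], the exponents [d_i e_i / k] over the [i] with [f i = v] add up to the
exponent of [v] in [m].  Such a choice counts for the product of the degrees of
the picked variables.  Only variables of [m] can be picked, which turns an
infinite sum into a finite one ([P_block_coef], [P_type_coef]).

Let [mtype m] be the type formed by the blocks [k^e], one for each variable
[x_{k,j}] of exponent [e > 0] in [m].  The variables of [m] are in bijection
with the rows of the tensor diagram of [mtype m]: a variable of degree [k] and
exponent [e] is a row of length [e] in component [k].  Picking the variable
[f i] amounts to laying brick [i] in the row [f i], and the condition on the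
exponents says that the bricks fill the rows exactly.  As labels increase along
a row, the row of each brick determines its position: it starts where the
bricks of smaller label in the same row end.  So the choices are the tabloids,
and the product of the degrees is the weight ([sum_wt_PTBT],
[P_type_coef_PTBT]).

Finally [m^tens_tau] is the indicator function of the monomials of type [tau]
([mtens_coef]).  Every type is the type of some monomial ([mtype_surj]), so the
coefficients of a combination of the [m^tens_tau] are read off at monomials of
the various types.  This gives the expansion and its uniqueness, which is what
the definition of the transition matrix by a choice operator requires. *)

Set Implicit Arguments.
Unset Strict Implicit.
Unset Printing Implicit Defensive.

Import GRing.Theory.
Local Open Scope ring_scope.

(** * Coefficients of products of series *)

Section Coefficients.
Implicit Types (m a : monomial) (f g : series) (v : nat * nat).

Lemma expcmnE m e v : expcmn m e v = (m v * e)%N.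
Proof.
case: e => [|e]; first by rewrite muln0 /expcmn /= onecmE.
rewrite /expcmn iteropS; elim: e => [|e IHe]; first by rewrite muln1.
by rewrite iterS mulcmE IHe -mulnS.
Qed.

Lemma prod_cmE (I : Type) (r : seq I) (F : I -> monomial) v :
  (\big[mmul/mone]_(i <- r) F i) v = (\sum_(i <- r) F i v)%N.
Proof.
by elim/big_rec2: _ => [|i x y _ <-]; [exact: cm1 | exact: cmM].
Qed.

(** Used for series whose product can reach a monomial in a single way, such as
series in disjoint sets of variables. *)
Lemma coefM_single f g a (b : monomial) :
  (forall x y, mmul x y = mmul a b -> (x, y) <> (a, b) -> f x * g y = 0) ->
  (f * g) (mmul a b) = f a * g b.
Proof.
move=> fg0; rewrite -[LHS]/(smul f g _) /smul.
rewrite -(@fsbig_widen _ _ _ _ [set (a, b)]) ?fsbig_set1 //=.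
  by move=> _ /= ->.
by move=> [x y] [/= xy xyN]; exact: fg0.
Qed.

Lemma coefM_eq0 f g m :
  (forall x y, mmul x y = m -> f x * g y = 0) -> (f * g) m = 0.
Proof.
move=> fg0; rewrite -[LHS]/(smul f g _) /smul fsbig1 // => -[x y] /= xy.
exact: fg0.
Qed.

Lemma monsM a (b : monomial) : mons a * mons b = mons (mmul a b).
Proof.
apply/funext => m; rewrite [RHS]/mons; have [->|mN] := eqVneq m (mmul a b).
  rewrite coefM_single /mons ?eqxx ?mulr1 // => x y _.
  by have [->|_] := eqVneq x a; have [->|_] := eqVneq y b; rewrite ?mulr0 ?mul0r.
apply: coefM_eq0 => x y xy; rewrite /mons.
have [xa|_] := eqVneq x a; last by rewrite mul0r.
have [yb|_] := eqVneq y b; last by rewrite mulr0.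
by rewrite -xy xa yb eqxx in mN.
Qed.

Lemma mons_prod (I : Type) (r : seq I) (F : I -> monomial) :
  \prod_(i <- r) mons (F i) = mons (\big[mmul/mone]_(i <- r) F i).
Proof.
by apply: (big_ind2 (fun x y => x = mons y)) => // ? ? ? ? -> ->; rewrite monsM.
Qed.

Lemma monsX a e : mons a ^+ e = mons (expcmn a e).
Proof.
elim: e => [|e IHe]; first by rewrite expr0.
rewrite exprS IHe monsM; congr mons; apply/eqP/cmP => v.
by rewrite cmM !expcmnE mulnS.
Qed.

Lemma series_scaleE (c : rat) f m : (c *: f) m = c * f m. Proof. by []. Qed.

Lemma series_sumE (I : Type) (r : seq I) (P : pred I) (F : I -> series) m :
  (\sum_(i <- r | P i) F i) m = \sum_(i <- r | P i) F i m.
Proof. by apply: (big_morph (fun f : series => f m)). Qed.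

(** The divisors of a monomial involve no new variable, so a coefficient of a
product depends only on the coefficients of the factors at monomials in the
given variables [V].  This is what allows infinite sums over the variables to be
truncated to finite ones inside a product. *)
Lemma eq_coef_prod (V : {fset nat * nat}) (I : Type) (r : seq I)
    (F G : I -> series) :
    (forall i m, {subset finsupp m <= V} -> F i m = G i m) ->
  forall m, {subset finsupp m <= V} ->
    (\prod_(i <- r) F i) m = (\prod_(i <- r) G i) m.
Proof.
move=> FG; elim: r => [|i r IHr] m mV; first by rewrite !big_nil.
rewrite !big_cons -[LHS]/(smul _ _ m) -[RHS]/(smul _ _ m).
apply: eq_fsbigr => -[x y]; rewrite inE /= => xy.
rewrite FG ?IHr // => v; rewrite -cmE_neq0 => vN;
  by apply: mV; rewrite -xy -cmE_neq0 cmM addn_eq0 negb_and vN ?orbT.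
Qed.

(** The sum defining the substitution has a single term, since raising to a
positive power is injective on monomials. *)
Lemma subst_pow_expcmn e f m :
  (0 < e)%N -> subst_pow e f (expcmn m e) = f m.
Proof.
move=> e0; rewrite /subst_pow -[RHS](fsbig_set1 +%R m f).
congr (\sum_(_ \in _) _); apply/seteqP; split=> [x /= xm|x /= ->] //.
apply/eqP/cmP => v; apply/eqP; move/(congr1 (fun m : monomial => m v))/eqP: xm.
by rewrite !expcmnE eqn_pmul2r.
Qed.

Lemma subst_pow_eq0 e f m :
  (forall x, expcmn x e <> m) -> subst_pow e f m = 0.
Proof. by move=> mN; rewrite /subst_pow fsbig1 // => x /= /mN. Qed.

Lemma power_sum_coef (V : {fset nat * nat}) (k p : nat) m :
    (0 < k)%N -> (0 < p)%N -> {subset finsupp m <= V} ->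
  series_sum [set j | (0 < j)%N] (fun j => var k j ^+ p) m
  = \sum_(v <- V | v.1.+1 == k) (m == expcmn (ucm v) p)%:R.
Proof.
move=> k0 p0 mV; rewrite /series_sum.
pose r := [seq v.2.+1 | v <- V & v.1.+1 == k].
rewrite -(@fsbig_widen _ _ _ _ [set` r]); last 2 first.
- by move=> j /= /mapP[v _ ->].
- move=> j [/= j0 jr]; rewrite /var monsX /mons.
  case: eqP => // mE; case: jr => /=.
  apply/mapP; exists (k.-1, j.-1); last by rewrite /= prednK.
  rewrite mem_filter /= prednK // eqxx; apply: mV.
  by rewrite -cmE_neq0 mE expcmnE cmU eqxx mul1n -lt0n.
rewrite -fsbig_seq; last first.
  rewrite map_inj_in_uniq ?filter_uniq ?fset_uniq // => -[a b] [a' b'].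
  rewrite !mem_filter /= => /andP[/eqP aE _] /andP[/eqP aE' _] [->].
  by case: aE' aE => <- [->].
rewrite big_map big_filter; apply: eq_bigr => v /eqP vk.
by rewrite /var monsX -vk; case: v {vk}.
Qed.

(** The monomial of [P_{d^e}] in the variable [x_v]: substituting [x^e] for [x]
turns the exponent [d / k] into [d e / k]. *)
Definition pick_mon (b : block) v : monomial :=
  expcmn (ucm v) (b.1 * b.2 %/ v.1.+1).

(** The double sum over the divisors [k] of [d] and over the variables of degree
[k] is a single sum over the variables whose degree divides [d]. *)
Lemma P_block_coef (V : {fset nat * nat}) (b : block) m :
    (0 < b.1)%N -> (0 < b.2)%N -> {subset finsupp m <= V} ->
  P_block b m =
  \sum_(v <- V | (v.1.+1 %| b.1)%N) v.1.+1%:R * (m == pick_mon b v)%:R.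
Proof.
case: b => d e /= d0 e0 mV; rewrite /P_block /=.
(* If m is no e-th power, neither are the monomials on the right: d e / k is a
   multiple of e. *)
have [[x xm]|mN] := pselect (exists x, expcmn x e = m); last first.
  rewrite subst_pow_eq0; last by move=> x xm; apply: mN; exists x.
  rewrite big1 // => v vd; case: eqP => [mE|]; last by rewrite mulr0.
  case: mN; exists (expcmn (ucm v) (d %/ v.1.+1)); rewrite mE.
  apply/eqP/cmP => w; rewrite !expcmnE /= -mulnA; congr (_ * _)%N.
  by rewrite divn_mulAC.
rewrite -xm subst_pow_expcmn // /P_deg series_sumE.
have xV : {subset finsupp x <= V}.
  move=> v; rewrite -cmE_neq0 => vx; apply: mV.
  by rewrite -xm -cmE_neq0 expcmnE muln_eq0 negb_or vx -lt0n.
pose F v : rat := v.1.+1%:R * (expcmn x e == pick_mon (d, e) v)%:R.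
transitivity (\sum_(k <- divisors d)
  \sum_(v <- V | (v.1.+1 %| d)%N && (v.1.+1 == k)) F v).
  apply: eq_big_seq => k; rewrite -dvdn_divisors // => kd.
  have k0 : (0 < k)%N by exact: dvdn_gt0 kd.
  have dk0 : (0 < d %/ k)%N by rewrite divn_gt0 // dvdn_leq.
  rewrite series_scaleE (power_sum_coef k0 dk0 xV) mulr_sumr.
  apply: eq_big => [v|v /eqP vk]; first by case: eqP => [->|]; rewrite ?kd ?andbF.
  rewrite /F vk; congr (_ * _%:R); congr nat_of_bool.
  apply/cmP/cmP => xE w.
    by rewrite /pick_mon expcmnE xE !expcmnE -mulnA /= vk divn_mulAC.
  move: (xE w); rewrite /pick_mon !expcmnE /= vk -divn_mulAC // mulnA => /eqP.
  by rewrite eqn_pmul2r // => /eqP.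
rewrite (exchange_big_dep (fun v => (v.1.+1 %| d)%N)) /=; last by move=> ? ? _ /andP[].
apply: eq_bigr => v vd; rewrite (eq_bigl (pred1 v.1.+1)); last first.
  by move=> k; rewrite vd eq_sym.
by rewrite -big_filter filter_pred1_uniq ?divisors_uniq -?dvdn_divisors // big_seq1.
Qed.

(** Distributing the product over the truncated sums makes the coefficient a sum
over the choices of one variable of [m] in each factor. *)
Lemma P_type_coef (sigma : seq block) m :
    all (fun b => (0 < b.1) && (0 < b.2))%N sigma ->
  P_type sigma m =
  \sum_(f : {ffun 'I_(size sigma) -> finsupp m} |
         [forall i : 'I_(size sigma), ((val (f i)).1.+1 %| (nth (0%N, 0%N) sigma i).1)%N] &&
         (m == \big[mmul/mone]_(i < size sigma) pick_mon (nth (0%N, 0%N) sigma i) (val (f i))))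
     (\prod_i (val (f i)).1.+1)%:R.
Proof.
(* Each factor is replaced by its truncation Q i to the variables of m. *)
move=> pos; rewrite /P_type (big_nth (0%N, 0%N)) big_mkord.
pose S := nth (0%N, 0%N) sigma.
pose w (i : 'I_(size sigma)) (v : finsupp m) : rat :=
  if ((val v).1.+1 %| (S i).1)%N then (val v).1.+1%:R else 0.
pose Q (i : 'I_(size sigma)) : series :=
  \sum_(v : finsupp m) w i v *: mons (pick_mon (S i) (val v)).
rewrite (@eq_coef_prod (finsupp m) _ _ _ Q) // => [|i x xV]; last first.
  have /andP[d0 e0] := all_nthP (0%N, 0%N) pos i (ltn_ord i).
  rewrite (P_block_coef d0 e0 xV) /Q series_sumE big_mkcond /= big_seq_fsetE /=.
  apply: eq_bigr => v _; rewrite series_scaleE /w; case: ifP => //.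
  by rewrite mul0r.
rewrite /Q bigA_distr_bigA series_sumE [RHS]big_mkcond /=.
apply: eq_bigr => f _; rewrite scaler_prod mons_prod series_scaleE.
case: forallP => [fd|/forallP]; last first.
  rewrite negb_forall => /existsP[i /negbTE fi].
  by rewrite (bigD1 i) //= {1}/w fi !mul0r.
rewrite (eq_bigr (fun i => (val (f i)).1.+1%:R)); last by move=> i _; rewrite /w fd.
by rewrite /mons /S; case: eqP => _; rewrite ?mulr1 ?mulr0 ?natr_prod.
Qed.
End Coefficients.

(** * Consecutive intervals *)

Section Intervals.
Local Open Scope nat_scope.

Lemma sum_interval (C a l : nat) :
  \sum_(c < C) (a <= c < a + l) = minn C (a + l) - minn C a.
Proof.
elim: C => [|C IHC]; first by rewrite big_ord0 !min0n.
rewrite big_ord_recr /= IHC.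
by case: (boolP (a <= C)) => ?; case: (boolP (C < a + l)) => ? /=; lia.
Qed.

Lemma sum_consecutive (s : nat) (l : nat -> nat) (c : nat) :
  \sum_(i < s) (\sum_(j < i) l j <= c < \sum_(j < i) l j + l i)
  = (c < \sum_(j < s) l j).
Proof.
elim: s => [|s IHs]; first by rewrite !big_ord0.
rewrite !big_ord_recr /= IHs; case: ltnP => //= cs.
by rewrite ltn_addr.
Qed.

(** Intervals of lengths [l i], laid end to end in the order of the indices in
[Q], cover each point of their total span exactly once.  This is the geometry of
one row of a tabloid, where [Q] selects the bricks of the row. *)
Lemma sum_consecutive_in (s : nat) (Q : pred 'I_s) (l : 'I_s -> nat) (c : nat) :
  let a i := \sum_(j < s | (j < i) && Q j) l j in
  \sum_(i < s | Q i) (a i <= c < a i + l i) = (c < \sum_(i < s | Q i) l i).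
Proof.
(* An index outside Q is given an empty interval. *)
pose l' j := oapp (fun i => if Q i then l i else 0) 0 (insub j : option 'I_s).
have l'E (i : 'I_s) : l' i = if Q i then l i else 0 by rewrite /l' valK.
move=> a.
have aE (i : 'I_s) : a i = \sum_(j < i) l' j.
  rewrite (big_ord_widen s) ?(ltnW (ltn_ord i)) // /a [RHS]big_mkcond [LHS]big_mkcond /=.
  by apply: eq_bigr => j _; rewrite l'E; case: (j < i) => //=; case: (Q j).
rewrite (big_mkcond Q l) -(eq_bigr _ (fun i _ => l'E i)) -sum_consecutive.
rewrite big_mkcond; apply: eq_bigr => i _; rewrite aE l'E.
by case: (Q i) => //; rewrite addn0; case: leqP => //= H; rewrite ltnNge H.
Qed.
End Intervals.

(** * Tabloids as assignments of bricks to rows *)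

(** The rows of the diagram of [tau] are indexed by a finite type [X]: the row [x]
is the row number [row x] of component [comp x] and has length [len x]. *)
Section Tabloids.
Local Open Scope nat_scope.
Variables (n : nat) (tau sigma : seq block) (X : finType).
Variables (comp row len : X -> nat).
Hypothesis sigma_pos : all (fun b => (0 < b.1) && (0 < b.2)) sigma.
Hypothesis comp_gt0 : forall x, 0 < comp x.
Hypothesis comp_le : forall x, comp x <= n.
Hypothesis row_lt : forall x, row x < n.
Hypothesis len_le : forall x, len x <= n.
Hypothesis row_inj : forall x y, comp x = comp y -> row x = row y -> x = y.
Hypothesis diagramP : forall k r c, in_diagram tau k r c <->
  exists x, [/\ comp x = k, row x = r & c < len x].

Notation s := (size sigma).
Notation deg i := (nth (0, 0) sigma i).1.
Notation mul i := (nth (0, 0) sigma i).2.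
Implicit Types (f g : {ffun 'I_s -> X}) (b : brick n s) (T : {set brick n s}).

Definition brick_length (i : 'I_s) (x : X) : nat := deg i * mul i %/ comp x.

(** [f i] is the row in which the brick labeled [i] is laid. *)
Definition admissible f : bool :=
  [forall i, comp (f i) %| deg i] &&
  [forall x, \sum_(i | f i == x) brick_length i x == len x].

(** Labels increase along a row, so brick [i] starts where the bricks of smaller
label in its row end. *)
Definition offset f (i : 'I_s) : nat :=
  \sum_(j < s | (j < i) && (f j == f i)) brick_length j (f i).

Definition tabloid f : {set brick n s} :=
  [set b | let i := blabel b in
    [&& bcomp b == comp (f i), brow b == row (f i), bcol b == offset f i
      & blen b == brick_length i (f i)]]%SET.

Lemma brick_length_gt0 (i : 'I_s) x : comp x %| deg i -> 0 < brick_length i x.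
Proof.
move=> xi; have /andP[d0 e0] := all_nthP (0, 0) sigma_pos i (ltn_ord i).
by rewrite divn_gt0 // (leq_trans (dvdn_leq d0 xi)) ?leq_pmulr.
Qed.

Lemma brick_eq b b' : blabel b = blabel b' -> bcomp b = bcomp b' ->
  brow b = brow b' -> bcol b = bcol b' -> blen b = blen b' -> b = b'.
Proof.
case: b b' => [[[[i k] r] c] l] [[[[i' k'] r'] c'] l'].
rewrite /blabel /bcomp /brow /bcol /blen /= => -> /val_inj -> /val_inj ->.
by move=> /val_inj -> /val_inj ->.
Qed.

Section OfAdmissible.
Variable f : {ffun 'I_s -> X}.
Hypothesis f_adm : admissible f.

Let f_dvd i : comp (f i) %| deg i.
Proof. by case/andP: f_adm => /forallP. Qed.

Let f_len x : \sum_(i | f i == x) brick_length i x = len x.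
Proof. by case/andP: f_adm => _ /forallP/(_ x)/eqP. Qed.

Lemma offset_brick_le i : offset f i + brick_length i (f i) <= len (f i).
Proof.
rewrite -f_len (bigD1 i) //= addnC leq_add2l /offset.
rewrite big_mkcond [leqRHS]big_mkcond leq_sum // => j _ /=.
have [->|] := eqVneq j i; first by rewrite ltnn.
by case: (j < i) => //=; case: (f j == f i).
Qed.

(** The numbers describing the bricks of [tabloid f] are within the bounds of the
type of bricks because they fit in the rows. *)
Lemma tabloid_brick : {b_ : 'I_s -> brick n s | forall i,
  [/\ blabel (b_ i) = i, bcomp (b_ i) = comp (f i), brow (b_ i) = row (f i),
      bcol (b_ i) = offset f i & blen (b_ i) = brick_length i (f i)]}.
Proof.
have off_lt i : offset f i < n.
  apply: leq_trans (len_le (f i)); apply: leq_trans (offset_brick_le i).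
  by rewrite -addn1 leq_add2l brick_length_gt0.
have len_lt i : brick_length i (f i) < n.+1.
  rewrite ltnS; apply: leq_trans (len_le (f i)).
  exact: leq_trans (leq_addl _ _) (offset_brick_le i).
exists (fun i => (i, Ordinal (comp_le (f i) : _ < n.+1), Ordinal (row_lt (f i)),
  Ordinal (off_lt i), Ordinal (len_lt i))).
by [].
Qed.

Let b_ := sval tabloid_brick.
Let b_P : forall i,
  [/\ blabel (b_ i) = i, bcomp (b_ i) = comp (f i), brow (b_ i) = row (f i),
      bcol (b_ i) = offset f i & blen (b_ i) = brick_length i (f i)]
  := svalP tabloid_brick.

Let b_inj : injective b_.
Proof.
by move=> i j bij; case: (b_P i) => <- _ _ _ _; case: (b_P j); rewrite bij.
Qed.

Let tabloidE : tabloid f = [set b_ i | i in 'I_s]%SET.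
Proof.
apply/setP => b; rewrite inE; apply/idP/imsetP => [|[i _ ->]].
  case/and4P=> /eqP k /eqP r /eqP c /eqP l; exists (blabel b) => //.
  by case: (b_P (blabel b)) => *; apply: brick_eq; congruence.
by case: (b_P i) => -> -> -> -> -> /=; rewrite ?eqxx.
Qed.

Let card_tabloid (Q : pred (brick n s)) :
  #|[set b in tabloid f | Q b]%SET| = \sum_i Q (b_ i).
Proof.
rewrite -sum1_card big_mkcond /=.
rewrite (eq_bigr (fun b => if b \in tabloid f then Q b : nat else 0)).
  by rewrite -big_mkcond /= tabloidE big_imset //= => i j _ _ /b_inj.
by move=> b _; rewrite inE; case: (b \in _); case: (Q b).
Qed.

Lemma tabloid_PTBT : tabloid f \in PTBT n tau sigma.
Proof.
rewrite inE; apply/asboolP; split.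
- move=> b; rewrite tabloidE => /imsetP[i _ ->] k r c /and3P[].
  case: (b_P i) => _ -> -> -> -> /eqP <- /eqP <- /andP[_ lt].
  by apply/diagramP; exists (f i); split=> //; apply: leq_trans (offset_brick_le i).
- move=> k r c /diagramP[x [xk xr xc]]; rewrite card_tabloid.
  have := sum_consecutive_in (fun i => f i == x) (fun i => brick_length i x) c.
  rewrite /= f_len xc /= => <-; rewrite [RHS]big_mkcond; apply: eq_bigr => i _.
  rewrite /covers; case: (b_P i) => _ -> -> -> ->.
  have [fx|fx] := eqVneq (f i) x; last first.
    apply/eqP; rewrite eqb0; apply/negP => /and3P[/eqP fk /eqP fr _].
    by case/eqP: fx; apply: row_inj; congruence.
  by rewrite /offset fx xk xr !eqxx.
- move=> b b'; rewrite tabloidE => /imsetP[i _ ->] /imsetP[j _ ->].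
  case: (b_P i) => -> -> -> -> _; case: (b_P j) => -> -> -> -> _.
  move=> fk fr; have fij := row_inj fk fr; apply: contraTT; rewrite -!leqNgt => ji.
  rewrite /offset fij big_mkcond [leqRHS]big_mkcond leq_sum // => h _ /=.
  by case: ltnP => //= hj; rewrite (leq_trans hj ji).
- move=> i; rewrite card_tabloid (bigD1 i) //= big1 => [|j ji].
    by case: (b_P i) => -> _ _ _ _; rewrite eqxx.
  by case: (b_P j) => -> _ _ _ _; rewrite (negbTE ji).
- move=> b; rewrite tabloidE => /imsetP[i _ ->].
  case: (b_P i) => -> -> _ _ ->; move: (f_dvd i); rewrite /brick_length.
  by case: (nth _ _ _).
Qed.

Lemma wt_tabloid : wt (tabloid f) = \prod_i comp (f i).
Proof.
transitivity (\prod_(b in tabloid f) bcomp b); last first.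
  rewrite tabloidE big_imset /=; last by move=> i j _ _ /b_inj.
  by apply: eq_bigr => i _; case: (b_P i).
rewrite /wt (eq_bigr (fun k => \prod_(b in tabloid f | bcomp b == k) bcomp b)).
  rewrite (exchange_big_dep (mem (tabloid f))) /=; last by move=> ? ? _ /andP[].
  apply: eq_bigr => b bT; rewrite (eq_bigl (pred1 (bcomp b))); last first.
    by move=> k; rewrite /= bT eq_sym.
  rewrite -big_filter filter_pred1_uniq ?iota_uniq ?big_seq1 //.
  rewrite mem_index_iota ltn_ord andbT; move: bT; rewrite tabloidE => /imsetP[i _ ->].
  by case: (b_P i) => _ -> _ _ _; exact: comp_gt0.
move=> k _; rewrite -prod_nat_const.
apply: eq_big => [b|b]; first by rewrite [LHS]inE.
by rewrite inE => /andP[_ /eqP].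
Qed.

Lemma tabloid_inj g : tabloid f = tabloid g -> f = g.
Proof.
move=> fg; apply/ffunP => i; have: b_ i \in tabloid g.
  by rewrite -fg tabloidE imset_f.
rewrite inE /=; case: (b_P i) => -> -> -> _ _ /and4P[/eqP fk /eqP fr _ _].
exact: row_inj.
Qed.
End OfAdmissible.

(** The column of brick [i] is found by counting the boxes to its left in its row:
each is covered once, and only by bricks of smaller label, which lie there
entirely.  In the same way, counting all the boxes of a row shows that the
lengths of its bricks add up to its length. *)
Lemma PTBT_tabloid T : T \in PTBT n tau sigma ->
  exists2 f, admissible f & T = tabloid f.
Proof.
rewrite inE => /asboolP[ins cov inc lab lth].
(* be i is the brick of T labeled i. *)
have /fin_all_exists[be beP] (i : 'I_s) :
    exists b, [set b' in T | blabel b' == i]%SET = [set b]%SET.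
  by have /eqP/cards1P := lab i.
have beT i : be i \in T by have /setP/(_ (be i)) := beP i; rewrite !inE eqxx => /andP[].
have beL i : blabel (be i) = i.
  by have /setP/(_ (be i)) := beP i; rewrite !inE eqxx => /andP[_ /eqP].
have beE b : b \in T -> b = be (blabel b).
  move=> bT; have /setP/(_ b) := beP (blabel b).
  by rewrite !inE eqxx bT => /esym/eqP.
have be_len i : (bcomp (be i) %| deg i) /\
    blen (be i) = deg i * mul i %/ bcomp (be i).
  by have := lth _ (beT i); rewrite beL; case: (nth _ _ _).
(* Bricks are nonempty, so brick i has a last box, which tells its row and that
   it ends within it. *)
have /fin_all_exists[f0 f0P] (i : 'I_s) : exists x : X,
    [/\ comp x = bcomp (be i), row x = brow (be i)
      & bcol (be i) + blen (be i) <= len x].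
  have [di li] := be_len i.
  have li0 : 0 < blen (be i).
    have /andP[d0 e0] := all_nthP (0, 0) sigma_pos i (ltn_ord i).
    by rewrite li divn_gt0 ?(dvdn_gt0 d0) // (leq_trans (dvdn_leq d0 di)) ?leq_pmulr.
  have last_box : covers (be i) (bcomp (be i)) (brow (be i))
      (bcol (be i) + blen (be i)).-1 by rewrite /covers !eqxx /=; lia.
  have /diagramP[x [xk xr xc]] := ins _ (beT i) _ _ _ last_box.
  by exists x; split=> //; move: xc; rewrite prednK // addn_gt0 li0 orbT.
pose f : {ffun 'I_s -> X} := [ffun i => f0 i].
have fP i : [/\ comp (f i) = bcomp (be i), row (f i) = brow (be i)
    & bcol (be i) + blen (be i) <= len (f i)] by rewrite ffunE.
have f_dvd i : comp (f i) %| deg i by case: (fP i) => -> _ _; case: (be_len i).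
have be_lenE i : blen (be i) = brick_length i (f i).
  by rewrite /brick_length; case: (fP i) => -> _ _; case: (be_len i).
have be_len0 i : 0 < blen (be i) by rewrite be_lenE brick_length_gt0.
have covE i x c : covers (be i) (comp x) (row x) c =
    (f i == x) && (bcol (be i) <= c < bcol (be i) + blen (be i)).
  rewrite /covers; case: (fP i) => <- <- _; have [->|fx] := eqVneq (f i) x.
    by rewrite !eqxx.
  apply/negP => /and3P[/eqP fk /eqP fr _]; case/eqP: fx; exact: row_inj.
have TE : T = [set be i | i in 'I_s]%SET.
  apply/setP => b; apply/idP/imsetP => [/beE ->|[i _ ->]] //.
  by exists (blabel b).
have cov1 x c : c < len x -> \sum_i covers (be i) (comp x) (row x) c = 1.
  move=> cx; rewrite -(cov (comp x) (row x) c); last by apply/diagramP; exists x.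
  rewrite -sum1_card; apply/esym; rewrite [LHS]big_mkcond /=.
  transitivity (\sum_(b in [set be i | i in 'I_s]%SET)
      covers b (comp x) (row x) c : nat); last first.
    by rewrite big_imset //= => i j _ _ ij; rewrite -(beL i) ij beL.
  rewrite [RHS]big_mkcond; apply: eq_bigr => b _; rewrite inE -TE.
  by case: (b \in T) => //=; case: covers.
have cov_uniq i j x c : covers (be i) (comp x) (row x) c ->
    covers (be j) (comp x) (row x) c -> i = j.
  move=> ci cj; have cx : c < len x.
    have /diagramP[y [yk yr yc]] := ins _ (beT i) _ _ _ ci.
    by rewrite -(row_inj yk yr).
  have /eqP := cov1 x c cx; rewrite (bigD1 i) //= ci; have [//|ji] := eqVneq j i.
  by rewrite (bigD1 j) //= cj.
have f_len x : \sum_(i | f i == x) brick_length i x = len x.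
  transitivity (\sum_i \sum_(c < len x) covers (be i) (comp x) (row x) c : nat).
    rewrite big_mkcond; apply: eq_bigr => i _.
    under eq_bigr do rewrite covE; have [fx|_] /= := eqVneq (f i) x; last first.
      by rewrite big1.
    rewrite sum_interval; case: (fP i); rewrite fx => _ _ le.
    by have := be_lenE i; rewrite fx; lia.
  rewrite exchange_big /= (eq_bigr (fun=> 1)) ?sum1_card ?card_ord // => c _.
  exact: cov1.
have off i : bcol (be i) = offset f i.
  have [_ _ le] := fP i.
  transitivity (\sum_j \sum_(c < bcol (be i))
      covers (be j) (comp (f i)) (row (f i)) c).
    rewrite exchange_big /= (eq_bigr (fun=> 1)) ?sum1_card ?card_ord // => c _.
    by apply: cov1; apply: leq_trans le; rewrite ltn_addr.
  rewrite /offset [RHS]big_mkcond; apply: eq_bigr => j _.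
  under eq_bigr do rewrite covE.
  have [fji|_] /= := eqVneq (f j) (f i); last by rewrite andbF big1.
  rewrite sum_interval andbT -fji -be_lenE.
  have [kj rj _] := fP j; have [ki ri _] := fP i.
  have kij : bcomp (be j) = bcomp (be i) by rewrite -kj -ki fji.
  have rij : brow (be j) = brow (be i) by rewrite -rj -ri fji.
  have lt_label (a b : 'I_s) : f a = f b -> bcol (be a) < bcol (be b) -> a < b.
    move=> fab ab; have [ka ra _] := fP a; have [kb rb _] := fP b.
    by rewrite -[a]beL -[b]beL; apply: inc => //; congruence.
  have disj c : bcol (be j) <= c < bcol (be j) + blen (be j) ->
      bcol (be i) <= c < bcol (be i) + blen (be i) -> j = i.
    by move=> cj ci; apply: (cov_uniq _ _ (f i) c); rewrite covE ?fji eqxx.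
  case: (ltngtP (bcol (be j)) (bcol (be i))) => [ltc|gtc|eqc].
  - rewrite (lt_label _ _ fji ltc).
    suff: bcol (be j) + blen (be j) <= bcol (be i) by lia.
    rewrite leqNgt; apply/negP => lt; have ji : j = i.
      by apply: (disj (bcol (be i))); have := be_len0 i; lia.
    by rewrite ji ltnn in ltc.
  - have ij := lt_label _ _ (esym fji) gtc.
    by have -> : (j < i) = false; lia.
  - have -> : j = i.
      by apply: (disj (bcol (be i))); have := be_len0 i; have := be_len0 j; lia.
    by rewrite ltnn; lia.
exists f.
  apply/andP; split; apply/forallP => // x; exact/eqP.
apply/setP => b; rewrite [RHS]inE /=; apply/idP/and4P => [bT|].
  rewrite (beE b bT) beL -off be_lenE.
  by case: (fP (blabel b)) => -> -> _; split.
case=> /eqP k /eqP r /eqP c /eqP l; have [ki ri _] := fP (blabel b).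
suff -> : b = be (blabel b) by [].
by apply: brick_eq; rewrite ?beL ?off ?be_lenE; congruence.
Qed.

Theorem sum_wt_PTBT :
  (\sum_(T in PTBT n tau sigma) wt T)%N =
  \sum_(f | admissible f) \prod_i comp (f i).
Proof.
have -> : PTBT n tau sigma = [set tabloid f | f in [set f | admissible f]]%SET.
  apply/setP => T; apply/idP/imsetP => [/PTBT_tabloid[f fA ->]|[f]].
    by exists f; rewrite ?inE.
  by rewrite inE => fA ->; exact: tabloid_PTBT.
rewrite big_imset /= => [|f g]; last by rewrite inE => fA _; exact: tabloid_inj.
by apply: eq_big => f; rewrite inE // => /wt_tabloid.
Qed.
End Tabloids.

(** * The type of a monomial *)

Section Blocks.
Implicit Types (m : monomial) (t : seq block) (v : nat * nat).

Definition restrict (A : pred (nat * nat)) m : monomial :=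
  mkcmonom [fsfun v in finsupp m => if A v then m v else 0%N | 0%N].

Lemma restrictE A m v : restrict A m v = if A v then m v else 0%N.
Proof.
by rewrite cmE fsfun_fun; case: finsuppP => // _; case: (A v).
Qed.

Lemma mul_restrict A m : mmul (restrict A m) (restrict (predC A) m) = m.
Proof.
apply/eqP/cmP => v; rewrite cmM !restrictE /=.
by case: (A v); rewrite ?addn0 ?add0n.
Qed.

Lemma finsupp_restrict A m :
  perm_eq (finsupp (restrict A m)) [seq v <- finsupp m | A v].
Proof.
apply: uniq_perm; rewrite ?filter_uniq ?fset_uniq // => v.
rewrite mem_filter -!cmE_neq0 restrictE.
by case: (A v); rewrite ?eqxx.
Qed.

(** The blocks of the type of [m], in the arbitrary order in which its variables
are enumerated. *)
Definition blocks m : seq block := [seq (v.1.+1, m v) | v <- finsupp m].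

Lemma mults_blocks m k :
  mults (blocks m) k = [seq m v | v <- finsupp m & v.1.+1 == k].
Proof. by rewrite /mults /blocks filter_map -map_comp. Qed.

Lemma mults_restrict (A : pred (nat * nat)) m k : (forall v, v.1.+1 = k -> A v) ->
  perm_eq (mults (blocks (restrict A m)) k) (mults (blocks m) k).
Proof.
move=> Ak; rewrite !mults_blocks.
have -> : [seq restrict A m v | v <- finsupp (restrict A m) & v.1.+1 == k]
        = [seq m v | v <- finsupp (restrict A m) & v.1.+1 == k].
  apply/eq_in_map => v; rewrite mem_filter => /andP[/eqP vk _].
  by rewrite restrictE Ak.
apply: perm_map; rewrite (permPl (perm_filter _ (finsupp_restrict A m))).
rewrite -filter_predI (eq_filter (a2 := fun v => v.1.+1 == k)) // => v /=.
by case: eqP => // vk; rewrite Ak.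
Qed.

Lemma msym_eq0 k lambda m v : msym k lambda m != 0 -> v.1.+1 != k -> m v = 0%N.
Proof.
rewrite /msym; case: allP => [mk _ vk|]; last by rewrite eqxx.
apply/eqP; rewrite cmE_eq0; apply: contra vk => /mk; exact.
Qed.

(** The factors involve disjoint sets of variables, so the only factorization of
[m] that contributes is the one that sorts the variables of [m] by degree. *)
Lemma prod_msym_coef (lam : nat -> seq nat) (r : seq nat) m : uniq r ->
  (\prod_(k <- r) msym k (lam k)) m =
  (all (fun v => v.1.+1 \in r) (finsupp m) &&
   all (fun k => perm_eq (mults (blocks m) k) (lam k)) r)%:R.
Proof.
elim: r m => [|k r IHr] m.
  rewrite big_nil andbT => _; rewrite -[LHS]/(mons mone m) /mons.
  congr (nat_of_bool _)%:R; apply/eqP/allP => [-> v|m0].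
    by rewrite -cmE_neq0 cm1.
  apply/eqP/cmP => v; rewrite cm1; apply/eqP; rewrite cmE_eq0.
  by apply/negP => /m0.
rewrite big_cons /= => /andP[kr r_uniq].
pose A v := v.1.+1 == k; set G := \prod_(j <- r) _.
rewrite -{1}(mul_restrict A m) coefM_single; last first.
  move=> x y; rewrite mul_restrict => xy xyN; apply/eqP; apply: contra_notT xyN.
  rewrite mulf_eq0 negb_or => /andP[x0]; rewrite /G IHr //.
  case: andP => [[/allP yr _] _|_]; last by rewrite eqxx.
  have xk v : v.1.+1 != k -> x v = 0%N by exact: msym_eq0 x0.
  have yk v : v.1.+1 = k -> y v = 0%N.
    move=> vk; apply/eqP; rewrite cmE_eq0; apply: contra kr => /yr.
    by rewrite vk.
  by congr (_, _); apply/eqP/cmP => v; rewrite restrictE -xy cmM /= /A;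
     have [/yk ->|/xk ->] := eqVneq v.1.+1 k; rewrite ?addn0.
rewrite /G IHr // /msym -natrM mulnb; congr (nat_of_bool _)%:R.
have -> : all (fun v => v.1.+1 == k) (finsupp (restrict A m)).
  by rewrite (perm_all _ (finsupp_restrict A m)) filter_all.
have -> : perm_eq [seq restrict A m v | v <- finsupp (restrict A m)] (lam k)
        = perm_eq (mults (blocks m) k) (lam k).
  rewrite mults_blocks.
  rewrite (_ : [seq restrict A m v | v <- finsupp (restrict A m)] = map m (finsupp (restrict A m))).
    by apply: (permPl _ (lam k)); apply/perm_map/finsupp_restrict.
  apply/eq_in_map => v; rewrite (perm_mem (finsupp_restrict A m)) mem_filter.
  by case/andP=> Av _; rewrite restrictE Av.
have -> : all (fun v => v.1.+1 \in r) (finsupp (restrict (predC A) m))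
        = all (fun v => v.1.+1 \in k :: r) (finsupp m).
  rewrite (perm_all _ (finsupp_restrict _ m)) all_filter.
  by apply: eq_all => v; rewrite /= inE /A; case: eqP.
have -> : all (fun j => perm_eq (mults (blocks (restrict (predC A) m)) j) (lam j)) r
        = all (fun j => perm_eq (mults (blocks m) j) (lam j)) r.
  apply: eq_in_all => j jr; apply: (permPl _ (lam j)); apply: mults_restrict => v vj /=.
  by rewrite /A vj; apply: contraNneq kr => <-.
by rewrite andbCA.
Qed.

Lemma count_mults t k e : count_mem e (mults t k) = count_mem (k, e) t.
Proof.
rewrite /mults count_map count_filter; apply: eq_count => -[d f].
by rewrite /= xpair_eqE andbC.
Qed.

Lemma perm_eq_mults t t' :
  (forall k, perm_eq (mults t k) (mults t' k)) <-> perm_eq t t'.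
Proof.
split=> [tt' | tt' k]; last exact/perm_map/perm_filter.
apply/allP => -[k e] _ /=; rewrite -!count_mults.
by have /permP -> := tt' k.
Qed.

Lemma is_type_pos t : is_type t -> all (fun b => (0 < b.1) && (0 < b.2))%N t.
Proof. by case/andP. Qed.

Lemma type_degree t b : is_type t -> b \in t -> (0 < b.1 <= weight t)%N.
Proof.
case/andP=> /allP pos _ bt; have /andP[d0 e0] := pos b bt.
by rewrite d0 (leq_trans _ (weight_ge bt)) // leq_pmulr.
Qed.

Lemma mults_nil t k : (forall b, b \in t -> b.1 != k) -> mults t k = [::].
Proof.
move=> tk; rewrite /mults (@eq_in_filter _ _ pred0) ?filter_pred0 // => b bt.
exact/negbTE/tk.
Qed.

(** The range of the product over [k] loses nothing: no degree in a type exceeds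
its weight. *)
Lemma mtens_coef t m : is_type t -> mtens t m = (perm_eq (blocks m) t)%:R.
Proof.
move=> tP; rewrite /mtens prod_msym_coef ?iota_uniq //.
congr (nat_of_bool _)%:R; apply/andP/idP => [[/allP supp_le /allP ml]|mt].
  apply/perm_eq_mults => k; case: (boolP (k \in index_iota 1 (weight t).+1)).
    exact: ml.
  move=> kN; rewrite !mults_nil // => b.
    move=> bt; apply: contraNneq kN => <-; rewrite mem_index_iota ltnS.
    exact: type_degree.
  by case/mapP=> v /supp_le vr ->; apply: contraNneq kN => <-.
split; apply/allP; last by move=> k _; exact: (perm_eq_mults _ _).2.
move=> v vm.
rewrite mem_index_iota ltnS; apply: (@type_degree t (v.1.+1, m v)) => //.
by rewrite -(perm_mem mt); apply/mapP; exists v.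
Qed.

Lemma block_ge_total : total block_ge.
Proof. by move=> [a b] [d e]; rewrite /block_ge /=; lia. Qed.

Lemma block_ge_trans : transitive block_ge.
Proof. by move=> [a b] [d e] [f g]; rewrite /block_ge /=; lia. Qed.

Lemma block_ge_anti : antisymmetric block_ge.
Proof. by move=> [a b] [d e]; rewrite /block_ge /= => ?; congr pair; lia. Qed.

Definition mtype m : seq block := sort block_ge (blocks m).

Lemma perm_mtype m : perm_eq (blocks m) (mtype m).
Proof. by rewrite perm_sym perm_sort. Qed.

Lemma mtype_is_type m : is_type (mtype m).
Proof.
apply/andP; split; last exact: sort_sorted block_ge_total _.
rewrite -(perm_all _ (perm_mtype m)) all_map; apply/allP => v /=.
by rewrite -cmE_neq0 lt0n.
Qed.

Lemma perm_blocksE m t : is_type t -> perm_eq (blocks m) t = (t == mtype m).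
Proof.
move=> tP; apply/idP/eqP => [mt|->]; last exact: perm_mtype.
apply: (sorted_eq block_ge_trans block_ge_anti).
- by case/andP: tP.
- exact: sort_sorted block_ge_total _.
by rewrite -(permPl mt) perm_mtype.
Qed.

Lemma weight_mtype m : weight (mtype m) = (\sum_(v <- finsupp m) v.1.+1 * m v)%N.
Proof. by rewrite /weight -(perm_big _ (perm_mtype m)) big_map. Qed.

(** The witness uses one variable for each block, its second index being the
position of the block; this keeps equal blocks on different variables. *)
Lemma mtype_surj t : is_type t -> exists m, mtype m = t.
Proof.
move=> tP; pose S := nth (0%N, 0%N) t.
pose vs := [seq ((S i).1.-1, i) | i <- iota 0 (size t)].
have posS i : (i < size t)%N -> (0 < (S i).1)%N && (0 < (S i).2)%N.
  by move=> it; exact: (all_nthP _ (is_type_pos tP)).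
have vs_uniq : uniq vs.
  by rewrite map_inj_uniq ?iota_uniq // => i j [].
pose m : monomial := mkcmonom [fsfun v in seq_fset tt vs => (S v.2).2 | 0%N].
have mE v : m v = if v \in vs then (S v.2).2 else 0%N.
  by rewrite cmE fsfun_fun seq_fsetE.
have supp : perm_eq (finsupp m) vs.
  apply: uniq_perm; rewrite ?fset_uniq // => v; rewrite -cmE_neq0 mE.
  case: ifP => [/mapP[i]|]; last by rewrite eqxx.
  by rewrite mem_iota => it -> /=; have /andP[_] := posS i it; rewrite lt0n.
exists m; apply/esym/eqP; rewrite -perm_blocksE //.
rewrite /blocks (permPl (perm_map _ supp)) (_ : map _ _ = t) //.
rewrite -map_comp -[RHS](mkseq_nth (0%N, 0%N)); apply/eq_in_map => i it /=.
have ivs : ((S i).1.-1, i) \in vs by apply/mapP; exists i.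
rewrite mE ivs /= prednK; first by rewrite -/(S i); case: (S i).
by move: it; rewrite mem_iota => /posS/andP[].
Qed.

End Blocks.

(** * The variables of a monomial as the rows of a diagram *)

Section Rows.
Variable m : monomial.
Notation X := (finsupp m).
Notation n := (weight (mtype m)).
Local Open Scope nat_scope.

(** The variables of [m] in the order of their blocks in [mtype m]; those of equal
block are tied arbitrarily. *)
Definition vars : seq (nat * nat) :=
  sort (relpre (fun v => (v.1.+1, m v)) block_ge) (finsupp m).

Definition degree_vars k := [seq v <- vars | v.1.+1 == k].

Lemma mtypeE : mtype m = [seq (v.1.+1, m v) | v <- vars].
Proof. by rewrite /mtype /blocks sort_map. Qed.

Lemma mults_mtype k : mults (mtype m) k = [seq m v | v <- degree_vars k].
Proof. by rewrite mtypeE /mults filter_map -map_comp. Qed.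

Definition row_of (x : X) : nat := index (val x) (degree_vars (val x).1.+1).

Lemma mem_degree_vars k v : (v \in degree_vars k) = (v.1.+1 == k) && (v \in X).
Proof. by rewrite mem_filter mem_sort. Qed.

Lemma mem_row (x : X) : val x \in degree_vars (val x).1.+1.
Proof. by rewrite mem_degree_vars eqxx (valP x). Qed.

Lemma uniq_degree_vars k : uniq (degree_vars k).
Proof. by rewrite filter_uniq // sort_uniq fset_uniq. Qed.

Lemma row_of_inj (x y : X) :
  (val x).1.+1 = (val y).1.+1 -> row_of x = row_of y -> x = y.
Proof.
rewrite /row_of => xy; rewrite -xy => xyE; apply: val_inj.
by apply: (index_inj (0, 0) _ _ xyE); rewrite ?mem_row // xy mem_row.
Qed.

Lemma in_diagram_mtype k r c : in_diagram (mtype m) k r c <->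
  exists x : X, [/\ (val x).1.+1 = k, row_of x = r & c < m (val x)].
Proof.
rewrite /in_diagram mults_mtype size_map; split=> [[k0 rk]|[x [<- <- cx]]].
  rewrite (nth_map (0, 0)) // => cr; set v := nth _ _ r in cr.
  have: v \in degree_vars k by rewrite mem_nth.
  rewrite mem_degree_vars => /andP[/eqP vk vX].
  exists [` vX]%fset; split=> //=.
  by rewrite /row_of /= vk index_uniq ?uniq_degree_vars.
by rewrite index_mem mem_row (nth_map (0, 0)) ?index_mem ?nth_index ?mem_row.
Qed.

Lemma block_le_weight (x : X) : (val x).1.+1 * m (val x) <= n.
Proof.
apply: (@weight_ge _ ((val x).1.+1, m (val x))).
by rewrite mtypeE; apply/mapP; exists (val x); rewrite // mem_sort (valP x).
Qed.

Lemma exponent_gt0 (x : X) : 0 < m (val x).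
Proof. by rewrite lt0n cmE_neq0 (valP x). Qed.

Lemma row_of_lt (x : X) : row_of x < n.
Proof.
apply: leq_trans (size_le_weight (mtype_is_type m)).
rewrite mtypeE size_map; apply: (@leq_trans (size (degree_vars (val x).1.+1))).
  by rewrite index_mem mem_row.
by rewrite size_filter count_size.
Qed.

(** Filling each row of the diagram exactly means that the powers picked in the
factors multiply to [m]. *)
Lemma admissibleE (sigma : seq block) (f : {ffun 'I_(size sigma) -> X}) :
  admissible (fun x : X => (val x).1.+1) (fun x : X => m (val x)) f =
  [forall i : 'I_(size sigma),
     (val (f i)).1.+1 %| (nth (0, 0) sigma i).1] &&
  (m == \big[mmul/mone]_(i < size sigma)
          pick_mon (nth (0, 0) sigma i) (val (f i))).
Proof.
rewrite /admissible; congr andb; have sumE v :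
    (\big[mmul/mone]_(i < size sigma)
       pick_mon (nth (0, 0) sigma i) (val (f i))) v =
    \sum_(i | val (f i) == v) brick_length (fun x : X => (val x).1.+1) i (f i).
  rewrite prod_cmE [RHS]big_mkcond; apply: eq_bigr => i _.
  by rewrite /pick_mon expcmnE cmU; case: eqP; rewrite ?mul0n ?mul1n.
apply/forallP/cmP => [fx v|mE x].
  rewrite sumE; have [vX|vN] := boolP (v \in X).
    rewrite -[v]/(val [` vX]%fset) -(eqP (fx [` vX]%fset)).
    by apply: eq_big => [i|i /eqP ->].
  rewrite big1; last by move=> i /eqP iv; rewrite -iv (valP (f i)) in vN.
  by apply/eqP; rewrite cmE_eq0.
by rewrite mE sumE; apply/eqP; apply: eq_big => [i|i /eqP ->].
Qed.
End Rows.

(** * The coefficients of [P_sigma] and the transition matrix *)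

Lemma P_type_coef_PTBT (sigma : seq block) (m : monomial) :
    all (fun b => (0 < b.1) && (0 < b.2))%N sigma ->
  P_type sigma m =
  \sum_(T in PTBT (weight (mtype m)) (mtype m) sigma) (wt T)%:R.
Proof.
move=> pos; rewrite P_type_coef // -[RHS]natr_sum.
rewrite (@sum_wt_PTBT _ _ _ (finsupp m) (fun x => (val x).1.+1) (@row_of m)
  (fun x => m (val x)) pos); first 1 last.
- by [].
- move=> x; apply: leq_trans (block_le_weight x).
  by rewrite leq_pmulr ?exponent_gt0.
- exact: row_of_lt.
- by move=> x; apply: leq_trans (block_le_weight x); rewrite leq_pmull.
- exact: row_of_inj.
- exact: in_diagram_mtype.
by rewrite natr_sum; apply: eq_bigl => f; rewrite admissibleE.
Qed.

(** Picking [x_v] of degree [k] in [P_{d^e}] contributes [k (d e / k) = d e] to the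
weight, whatever [v] is. *)
Lemma P_type_homogeneous (sigma : seq block) (m : monomial) :
    all (fun b => (0 < b.1) && (0 < b.2))%N sigma ->
  weight (mtype m) != weight sigma -> P_type sigma m = 0.
Proof.
move=> pos mN; rewrite P_type_coef // big1 // => f /andP[/forallP fd /eqP mE].
case/eqP: mN; rewrite weight_mtype /weight [RHS](big_nth (0%N, 0%N)) [RHS]big_mkord.
rewrite big_seq_fsetE /=.
transitivity (\sum_(v : finsupp m) \sum_(i < size sigma)
    (val v).1.+1 * pick_mon (nth (0, 0) sigma i) (val (f i)) (val v))%N.
  apply: eq_bigr => v _; rewrite -big_distrr -prod_cmE; congr (_ * _)%N.
  exact (congr1 (fun x : monomial => x (val v)) mE).
rewrite exchange_big /=; apply: eq_bigr => i _.
rewrite (bigD1 (f i)) //= big1 => [|v vf].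
  by rewrite addn0 expcmnE cmU eqxx mul1n [LHS]mulnC divnK // dvdn_mulr // fd.
by rewrite expcmnE cmU (inj_eq val_inj) eq_sym (negbTE vf) mul0n muln0.
Qed.

(** The [mtens t] are indicator functions of disjoint sets of monomials. *)
Lemma mtens_comb_coef n (c : ptype n -> rat) (m : monomial) (tau : ptype n) :
  mtype m = tau -> (\sum_(t : ptype n) c t *: mtens t) m = c tau.
Proof.
move=> mt; rewrite series_sumE (bigD1 tau) //= series_scaleE.
have tyP (t : ptype n) : is_type t by case/andP: (ptypeP t).
rewrite mtens_coef // perm_blocksE // mt eqxx mulr1 big1 ?addr0 // => t tN.
rewrite series_scaleE mtens_coef // perm_blocksE // mt (inj_eq val_inj).
by rewrite (negbTE tN) mulr0.
Qed.

Theorem corollary55 (n : nat) (sigma tau : ptype n) :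
  transition (fun s => P_type s) (fun t => mtens t) tau sigma
  = \sum_(T in PTBT n tau sigma) (wt T)%:R.
Proof.
have tyP (t : ptype n) : is_type t by case/andP: (ptypeP t).
have wtP (t : ptype n) : weight t = n by case/andP: (ptypeP t) => _ /eqP.
pose N (t s : ptype n) : rat := \sum_(T in PTBT n t s) (wt T)%:R.
rewrite /transition (@xget_subset1 _ _ _ N) //.
  (* The tabloid matrix gives an expansion. *)
  move=> s; apply/funext => m; have [mn|mn] := eqVneq (weight (mtype m)) n.
    have mP : is_type (mtype m) && (weight (mtype m) == n).
      by rewrite mtype_is_type mn eqxx.
    rewrite (@mtens_comb_coef _ (N^~ s) m (PType mP)) //.
    by rewrite P_type_coef_PTBT ?is_type_pos // mn.
  rewrite P_type_homogeneous ?is_type_pos ?wtP // series_sumE big1 // => t _.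
  rewrite series_scaleE mtens_coef // perm_blocksE //.
  by case: eqP => [tm|_]; rewrite ?mulr0 //; rewrite -tm wtP eqxx in mn.
(* Two expansions agree at a monomial of each type. *)
move=> M M' /= MP M'P; apply/funext => t; apply/funext => s.
have [m mt] := mtype_surj (tyP t).
rewrite -(mtens_comb_coef (M^~ s) mt) -(mtens_comb_coef (M'^~ s) mt).
by rewrite -MP -M'P.
Qed.
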